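(* Let $F$ be a field and let $\emptyset\neq X\subseteq\operatorname{Zar}(F)$ be such that $J(X)\neq 0$. If $A(X)$ is a completely integrally closed local ring and not a valuation ring of $F$, then $A(X)=A(Y)$ for every co-countable subset $Y$ of $\lim(X)$ (that is, every $Y\subseteq\lim(X)$ with $\lim(X)\setminus Y$ countable).
   Context: A valuation ring of the field $F$ is a subring $V$ of $F$ such that for each $0\ne t\in F$, $t\in V$ or $t^{-1}\in V$ (so $F$ itself is one); $\mathfrak M_V$ denotes its maximal ideal, and $\operatorname{Zar}(F)$ is the set of all valuation rings of $F$. For nonempty $X\subseteq\operatorname{Zar}(F)$ put $A(X)=\bigcap_{V\in X}V$ and $J(X)=\bigcap_{V\in X}\mathfrak M_V$. The patch topology on $\operatorname{Zar}(F)$ is the topology having as a basis the sets $\{V: x_1,\dots,x_n\in V,\ y_1\notin V,\dots,y_m\notin V\}$ with $x_i,y_j\in F$, $n,m\ge 0$ (it is compact Hausdorff). $\lim(X)$ is the set of limit points of $X$ in $\operatorname{Zar}(F)$ in the patch topology, i.e. those $U\in\operatorname{Zar}(F)$ such that every patch open neighborhood of $U$ contains a point of $X$ different from $U$. A local ring is a commutative ring with a unique maximal ideal (not necessarily Noetherian). A domain $A$ with quotient field $Q(A)$ is completely integrally closed if every $t\in Q(A)$ for which there is $0\neq a\in A$ with $at^n\in A$ for all $n>0$ lies in $A$. *)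

(* Defs.v *)
From HB Require Import structures.
From mathcomp Require Import all_boot all_order all_algebra.
From mathcomp Require Import all_classical all_reals all_analysis.

Set Implicit Arguments.
Unset Strict Implicit.
Unset Printing Implicit Defensive.

Import GRing.Theory.

Local Open Scope classical_set_scope.
Local Open Scope ring_scope.

Section Rings.
Variable F : fieldType.
Implicit Types A V I M : set F.

Definition is_subring A : Prop := GRing.subring_closed (mem A).

(* Subrings of F are sets, so an ideal of A is a subset of F contained in A. *)
Definition is_ideal A I : Prop :=
  [/\ I `<=` A, I 0, (forall x y, I x -> I y -> I (x + y))
    & (forall a x, A a -> I x -> I (a * x))].

Definition is_maximal_ideal A M : Prop :=
  [/\ is_ideal A M, M <> A &
      forall I, is_ideal A I -> M `<=` I -> I = M \/ I = A].

Definition is_local_ring A : Prop :=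
  is_subring A /\ exists! M, is_maximal_ideal A M.

Definition is_valuation_ring V : Prop :=
  is_subring V /\ forall t : F, t != 0 -> V t \/ V t^-1.

(* The quotient field of A taken inside F; it may be smaller than F. *)
Definition quotient_field A : set F :=
  [set t | exists a b, [/\ A a, A b, b != 0 & t = a / b]].

Definition completely_integrally_closed A : Prop :=
  forall t, quotient_field A t ->
    (exists a, [/\ A a, a != 0 & forall n, (0 < n)%N -> A (a * t ^+ n)]) ->
    A t.

(* Junk value set0 if A has no maximal ideal; see maximal_ideal_ZarP. *)
Definition maximal_ideal A : set F := xget set0 (is_maximal_ideal A).

End Rings.

Record Zar (F : fieldType) := MkZar {
  Zar_set :> set F;
  Zar_valuation_ring : is_valuation_ring Zar_set }.

HB.instance Definition _ (F : fieldType) := gen_eqMixin (Zar F).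
HB.instance Definition _ (F : fieldType) := gen_choiceMixin (Zar F).

Section PatchTopology.
Variable F : fieldType.

Definition patch_basic (xs ys : seq F) : set (Zar F) :=
  [set V : Zar F | (forall x, x \in xs -> Zar_set V x) /\
                   (forall y, y \in ys -> ~ Zar_set V y)].

Definition patch_basis : set (set (Zar F)) :=
  [set B | exists xs ys, B = patch_basic xs ys].

Lemma patch_basis_cover : \bigcup_(B in patch_basis) B = setT.
Proof.
by rewrite -subTset => V _; exists (patch_basic [::] [::]) => //; exists [::], [::].
Qed.

Lemma patch_basis_join (B C : set (Zar F)) (V : Zar F) :
  patch_basis B -> patch_basis C -> B V -> C V ->
  exists D, [/\ patch_basis D, D V & D `<=` B `&` C].
Proof.
move=> [xs [ys ->]] [xs' [ys' ->]] [Vxs Vys] [Vxs' Vys'].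
exists (patch_basic (xs ++ xs') (ys ++ ys')); split.
- by exists (xs ++ xs'), (ys ++ ys').
- by split=> z; rewrite mem_cat => /orP[]; auto.
- move=> W [Wx Wy].
  by split; split=> z zin; (apply: Wx || apply: Wy); rewrite mem_cat zin ?orbT.
Qed.

HB.instance Definition _ :=
  @isBaseTopological.Build (Zar F) (set (Zar F)) patch_basis id
    patch_basis_cover patch_basis_join.

Lemma patch_nbhsE (U : Zar F) (W : set (Zar F)) : nbhs U W <->
  exists xs ys, patch_basic xs ys U /\ patch_basic xs ys `<=` W.
Proof.
rewrite nbhsE; split => [[G [[D DB GE] GU] GW]|[xs [ys [UB BW]]]].
  move: GU; rewrite -GE => -[B DB' BU]; have [xs [ys EB]] := DB _ DB'.
  exists xs, ys; rewrite -EB; split => // V BV.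
  by apply: GW; rewrite -GE; exists B.
exists (patch_basic xs ys) => //; split => //.
exists [set patch_basic xs ys]; last by rewrite bigcup_set1.
by move=> _ ->; exists xs, ys.
Qed.

End PatchTopology.

(* Over X = set0 both intersections are the whole of F. *)
Definition A_of (F : fieldType) (X : set (Zar F)) : set F :=
  \bigcap_(V in X) Zar_set V.

Definition J_of (F : fieldType) (X : set (Zar F)) : set F :=
  \bigcap_(V in X) maximal_ideal V.

Section MaximalIdealZar.
Variables (F : fieldType) (V : Zar F).

Let N : set F := [set x | Zar_set V x /\ (x = 0 \/ ~ Zar_set V x^-1)].

Let V1 : Zar_set V 1.
Proof. by case: (Zar_valuation_ring V) => -[/set_mem]. Qed.

Let VB x y : Zar_set V x -> Zar_set V y -> Zar_set V (x - y).
Proof.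
case: (Zar_valuation_ring V) => -[_ Vb _] _ Vx Vy.
by apply/set_mem/Vb; apply/mem_set.
Qed.

Let VM x y : Zar_set V x -> Zar_set V y -> Zar_set V (x * y).
Proof.
case: (Zar_valuation_ring V) => -[_ _ Vm] _ Vx Vy.
by apply/set_mem/Vm; apply/mem_set.
Qed.

Let V0 : Zar_set V 0.
Proof. by rewrite -(subrr 1); apply: VB. Qed.

Let VD x y : Zar_set V x -> Zar_set V y -> Zar_set V (x + y).
Proof.
by move=> Vx Vy; rewrite -[y]opprK; apply: VB => //; rewrite -sub0r; apply: VB.
Qed.

Let VT t : t != 0 -> Zar_set V t \/ Zar_set V t^-1.
Proof. by case: (Zar_valuation_ring V) => _; apply. Qed.

Let ND_aux x y : x != 0 -> y != 0 -> N x -> N y -> Zar_set V (x / y) ->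
  N (x + y).
Proof.
move=> x0 y0 [Vx _] [Vy [y00|nVy]] Vxy; first by rewrite y00 eqxx in y0.
split; first exact: VD.
have [->|xy0] := eqVneq (x + y) 0; [by left|right => Vxyi].
apply: nVy; have -> : y^-1 = (x / y + 1) * (x + y)^-1.
  apply: (mulIf xy0); rewrite mulfVK //.
  by rewrite mulrDr mulVf // mulrC.
by apply: VM => //; apply: VD.
Qed.

Let N_ideal : is_ideal V N.
Proof.
split.
- by move=> x [].
- by split=> //; left.
- move=> x y Nx Ny.
  have [->|x0] := eqVneq x 0; first by rewrite add0r.
  have [->|y0] := eqVneq y 0; first by rewrite addr0.
  have [Vxy|Vyx] : Zar_set V (x / y) \/ Zar_set V (x / y)^-1.
    by apply: VT; rewrite mulf_neq0 ?invr_eq0.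
  + exact: ND_aux.
  + by rewrite addrC; apply: ND_aux => //; rewrite -invf_div.
- move=> a x Va [Vx Nx]; split; first exact: VM.
  case: Nx => [->|nVx]; first by left; rewrite mulr0.
  have [->|a0] := eqVneq a 0; first by left; rewrite mul0r.
  right => Vax; apply: nVx; have -> : x^-1 = a * (a * x)^-1.
    by rewrite invfM mulrA divff // mul1r.
  exact: VM.
Qed.

Let proper_sub_N I : is_ideal V I -> I <> V -> I `<=` N.
Proof.
move=> [IV I0 _ IM] nIV x Ix; split; first exact: IV.
have [->|x0] := eqVneq x 0; [by left|right => Vxi].
apply: nIV; apply/seteqP; split => // v Vv.
by rewrite -[v](mulfVK x0); apply: IM => //; apply: VM.
Qed.

Let N_proper : N <> Zar_set V.
Proof.
move=> NV; have [_] : N 1 by rewrite NV.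
by case=> [/eqP|]; rewrite ?oner_eq0 // invr1; apply.
Qed.

Let N_max : is_maximal_ideal V N.
Proof.
split=> // I I_id NI; have [->|nIV] := pselect (I = Zar_set V); first by right.
by left; apply/seteqP; split=> //; apply: proper_sub_N.
Qed.

Let N_unique M : is_maximal_ideal V M -> M = N.
Proof.
move=> [M_id nMV Mmax].
by case: (Mmax N N_ideal (proper_sub_N M_id nMV)) => // /N_proper.
Qed.

Lemma maximal_ideal_ZarP (M : set F) :
  is_maximal_ideal V M <-> M = maximal_ideal V.
Proof.
have -> : maximal_ideal V = N by apply: xget_unique N_max N_unique.
by split=> [/N_unique|->].
Qed.

Lemma maximal_ideal_ZarE : maximal_ideal V =
  [set x | Zar_set V x /\ (x = 0 \/ ~ Zar_set V x^-1)].
Proof. exact: xget_unique N_max N_unique. Qed.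

End MaximalIdealZar.

(* Main.v *)
Require Import Defs.
From mathcomp Require Import all_boot all_order all_algebra.
From mathcomp Require Import all_classical all_reals all_analysis.

(** Why the theorem holds.

    Replacing X by its patch closure changes neither A(X) nor the limit points,
    and keeps every element of J(X).  The closure is compact, so by Zorn's lemma
    it contains a minimal closed Z with A(Z) = A(X)
    ([minimal_closed_representation]).

    The heart of the proof is that Z has no isolated point.  An isolated V in Z
    could be removed from Z without losing closedness, so by minimality some t
    lies in every other member of Z but not in V.  Let j in J(Z) be nonzero.
    Complete integral closedness yields n such that s = j t^n is not in V,
    although s is in the maximal ideal of every other member of Z.  Then
    e = (1 + s)^-1 lies in A(Z), is a nonunit in V, and 1 - e is a nonunit in
    every other member of Z.  A local ring contains no two nonunits with sum 1,
    so V is the only member of Z and A(X) = V is a valuation ring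
    ([local_irredundant_valuation]), which is excluded.

    Hence Z is perfect and consists of limit points of X.  If t is in A(Y) but
    not in A(X) = A(Z), the members of Z that omit t form a nonempty compact set
    without isolated points, contained in lim(X) minus Y.  Such a set is
    uncountable by a Cantor-style argument ([perfect_compact_uncountable]), so Y
    is not co-countable.  Conversely A(X) is contained in A(Y), since limit points
    of X lie in the closure of X. *)

Set Implicit Arguments.
Unset Strict Implicit.
Unset Printing Implicit Defensive.

Import GRing.Theory.

Local Open Scope classical_set_scope.
Local Open Scope ring_scope.

(** * Compact sets without isolated points *)

Section Topology.
Variable T : topologicalType.
Implicit Types (K E : set T) (G : set (set T)).

(** The sets K minus U, for U in G, form a filter base on K, whose cluster points
    avoid every U as U is open. *)
Lemma compact_chain_bigcup K G : compact K -> G !=set0 ->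
    total_on G subset ->
    (forall U, G U -> open U /\ K `\` U !=set0) ->
  K `\` \bigcup_(U in G) U !=set0.
Proof.
move=> cK [U0 GU0] Gtot GP.
pose H := filter_from G (fun U => K `\` U).
have HH : ProperFilter H.
  apply: filter_from_proper => [|U /GP[]//]; apply: filter_from_filter.
    by exists U0.
  move=> U U' GU GU'; have [UU'|U'U] := Gtot _ _ GU GU'.
    by exists U' => // x [Kx nU'x]; split; split => // /UU'.
  by exists U => // x [Kx nUx]; split; split => // /U'U.
have HK : H K by exists U0 => // x [].
have [p [Kp clp]] := cK H HH HK.
exists p; split => // -[U GU Up]; have [oU _] := GP _ GU.
have [||q [[_ nUq] Uq]] := clp (K `\` U) U; last by [].
  by exists U.
exact: open_nbhs_nbhs.
Qed.

(** Shrink a clopen set that meets K step by step, avoiding at step n the point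
    of K numbered n; this is always possible, as no point of K is isolated.  By
    compactness a point of K survives all steps, against its own number. *)
Theorem perfect_compact_uncountable K : zero_dimensional T ->
  compact K -> K !=set0 -> K `<=` limit_point K -> ~ countable K.
Proof.
move=> zdT cK [x0 Kx0] Kperf /countable_injP[f finj].
pose good U := clopen U /\ K `&` U !=set0.
have step (p : nat * set T) : exists U', good p.2 ->
    [/\ good U', U' `<=` p.2 & forall c, K c -> f c = p.1 -> ~ U' c].
  case: p => n U /=.
  have [[c [Kc fc]]|noc] := pselect (exists c, K c /\ f c = n); last first.
    by exists U => gU; split => // c Kc fc _; apply: noc; exists c.
  have [[clU [x [Kx Ux]]]|?] := pselect (good U); last by exists U.
  have [y [Ky Uy yc]] : exists y, [/\ K y, U y & y != c].
    have [xc|] := eqVneq x c; last by exists x.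
    have [|y [yx Ky Uy]] := Kperf _ Kx U.
      by apply: open_nbhs_nbhs; split => //; case: clU.
    by exists y; split => //; rewrite -xc.
  have [W [clW Wy nWc]] := zdT _ _ yc.
  exists (U `&` W) => _; split.
  - by split; [exact: clopenI|exists y].
  - by move=> z [].
  - move=> d Kd fd [_ Wd]; apply: nWc; suff <- : d = c by [].
    exact: finj (mem_set Kd) (mem_set Kc) (etrans fd (esym fc)).
have [g gP] := choice step.
pose u := fix u n := if n is m.+1 then g (m, u m) else setT.
have ugood n : good (u n).
  elim: n => [|n IH] /=; last by have [] := gP (n, u n) IH.
  by split; [exact: clopenT|exists x0].
have uS m n : (m <= n)%N -> u n `<=` u m.
  move=> /subnK <-; elim: (n - m)%N => // k IH.
  rewrite addSn /=; apply: subset_trans IH.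
  by have [] := gP ((k + m)%N, u (k + m)%N) (ugood _).
have [|||p [Kp nGp]] :=
    @compact_chain_bigcup K (range (fun n => ~` u n)) cK.
- by exists (~` u 0%N); exists 0%N.
- move=> _ _ [m _ <-] [n _ <-]; have [/uS|/ltnW/uS] := leqP m n.
    by move=> /subsetC; left.
  by move=> /subsetC; right.
- move=> _ [n _ <-]; have [clu [x [Kx ux]]] := ugood n.
  split; first by have [] := clopenC setT clu.
  by exists x; split => //; apply.
have [_ _ /(_ _ Kp erefl)] := gP (f p, u (f p)) (ugood (f p)).
apply; apply: contrapT => np; apply: nGp.
by exists (~` u (f p).+1) => //; exists (f p).+1.
Qed.

Lemma limit_point_closure E : accessible_space T ->
  limit_point (closure E) `<=` limit_point E.
Proof.
move=> T1 x xE U /= /nbhs_interior xU.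
have [y [yx Ey Uy]] := xE _ xU.
have yN : nbhs y (U `&` ~` [set x]).
  apply: filterI; first exact: Uy.
  apply: open_nbhs_nbhs; split; last exact/eqP.
  by apply: closed_openC; exact: accessible_closed_set1.
by have [z [Ez [Uz /eqP zx]]] := Ey _ yN; exists z.
Qed.

Lemma closed_setD1 E x : closed E -> ~ limit_point E x -> closed (E `\ x).
Proof.
move=> cE; rewrite not_limit_pointE => -[U xU EU].
have -> : E `\ x = E `&` ~` U°.
  apply/seteqP; split => y [Ey yx]; split => //.
    by move=> /interior_subset Uy; apply: yx; exact: EU.
  by move=> /= yx'; apply: yx; rewrite yx'.
by apply: closedI => //; apply: open_closedC; exact: open_interior.
Qed.

End Topology.

(** * Local subrings of a field *)

Section Subring.
Variables (F : fieldType) (A : set F).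
Hypothesis subA : is_subring A.

Lemma subring1 : A 1.
Proof. by case: subA => /set_mem. Qed.

Lemma subringB x y : A x -> A y -> A (x - y).
Proof.
by move=> Ax Ay; case: subA => _ sB _; apply/set_mem/sB; exact/mem_set.
Qed.

Lemma subringM x y : A x -> A y -> A (x * y).
Proof.
by move=> Ax Ay; case: subA => _ _ sM; apply/set_mem/sM; exact/mem_set.
Qed.

Lemma subring0 : A 0.
Proof. by rewrite -(subrr 1); apply: subringB; exact: subring1. Qed.

Lemma subringD x y : A x -> A y -> A (x + y).
Proof.
move=> Ax Ay; rewrite -[y]opprK; apply: subringB => //.
by rewrite -sub0r; apply: subringB => //; exact: subring0.
Qed.

Lemma subringX x n : A x -> A (x ^+ n).
Proof.
move=> Ax; elim: n => [|n IH]; first by rewrite expr0; exact: subring1.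
by rewrite exprS; exact: subringM.
Qed.

(** Krull's theorem, for ideals that are encoded as subsets of the field. *)
Lemma nonunit_maximal_ideal x : A x -> ~ A x^-1 ->
  exists2 M, is_maximal_ideal A M & M x.
Proof.
move=> Ax nAx.
(* The empty set is admitted because it is the union of the empty chain. *)
pose P I := I = set0 \/ [/\ is_ideal A I, ~ I 1 & I x].
have xax : [set x * a | a in A] x.
  by exists 1; rewrite ?mulr1 //; exact: subring1.
have Pxa : P [set x * a | a in A].
  right; split.
  - split.
    + by move=> _ [a Aa <-]; exact: subringM.
    + by exists 0; rewrite ?mulr0 //; exact: subring0.
    + move=> _ _ [a Aa <-] [b Ab <-]; exists (a + b); rewrite ?mulrDr //.
      exact: subringD.
    + move=> b _ Ab [a Aa <-]; exists (b * a); first exact: subringM.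
      by rewrite mulrCA.
  - by move=> [a Aa /mulr1_eq xa]; apply: nAx; rewrite xa.
  - exact: xax.
have [|M [PM Mmax]] := @Zorn_bigcup _ P.
  move=> G GP Gtot.
  have [[I0 [GI0 I0x]]|no] := pselect (exists I, G I /\ I x); last first.
    left; apply/seteqP; split => // y [I GI Iy].
    case: (GP _ GI) => [I0|[_ _ Ix]]; first by rewrite I0 in Iy.
    by case: no; exists I.
  have idG I y : G I -> I y -> is_ideal A I /\ ~ I 1.
    by move=> GI Iy; case: (GP _ GI) => [I0'|[]//]; rewrite I0' in Iy.
  right; split; last by exists I0.
    split.
    - by move=> y [I GI Iy]; have [[IA _ _ _] _] := idG _ _ GI Iy; exact: IA.
    - by exists I0 => //; have [[]] := idG _ _ GI0 I0x.
    - move=> y z [I GI Iy] [I' GI' Iz].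
      have [[_ _ ID _] _] := idG _ _ GI Iy.
      have [[_ _ ID' _] _] := idG _ _ GI' Iz.
      have [II'|I'I] := Gtot _ _ GI GI'.
        by exists I' => //; apply: ID' => //; exact: II'.
      by exists I => //; apply: ID => //; exact: I'I.
    - move=> a y Aa [I GI Iy]; have [[_ _ _ IM] _] := idG _ _ GI Iy.
      by exists I => //; exact: IM.
  by move=> [I GI I1]; have [_ ] := idG _ _ GI I1; apply.
(* A maximal member is not empty, as x A is an admissible set that is larger. *)
case: PM => [M0|[Mid nM1 Mx]].
  case: (Mmax _ _ Pxa); rewrite M0; split => // sub.
  by have := sub _ xax.
exists M => //; split => //.
  by move=> MA; apply: nM1; rewrite MA; exact: subring1.
move=> I [IA I0 ID IM] MI; have [I1|nI1] := pselect (I 1).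
  right; apply/seteqP; split => // a Aa.
  by rewrite -[a]mulr1; exact: IM.
left; apply: contrapT => nIM; apply: (Mmax I).
  by split => // IM'; apply: nIM; exact/seteqP.
by right; split => //; exact: MI.
Qed.

(** If x and 1 - x were both nonunits, each would lie in a maximal ideal; these
    ideals coincide and so contain 1. *)
Lemma local_ring_unit x : is_local_ring A -> A x -> A x^-1 \/ A (1 - x)^-1.
Proof.
move=> [_ [M [[[MA _ MD MM] nMA _] Muniq]]] Ax.
apply: contrapT => /not_orP[nAx nAy].
have Ay : A (1 - x) by apply: subringB => //; exact: subring1.
have [M1 /Muniq <- Mx] := nonunit_maximal_ideal Ax nAx.
have [M2 /Muniq <- My] := nonunit_maximal_ideal Ay nAy.
apply: nMA; apply/seteqP; split => // a Aa.
rewrite -[a]mulr1 -(subrK x 1); apply: MM => //; exact: MD.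
Qed.

End Subring.

(** * Valuation rings and the patch topology *)

Section ZariskiRiemann.
Variable F : fieldType.
Implicit Types (V W : Zar F) (X Y Z : set (Zar F)).

Lemma Zar_subring V : is_subring V.
Proof. by case: (Zar_valuation_ring V). Qed.

Lemma Zar_total V t : t != 0 -> Zar_set V t \/ Zar_set V t^-1.
Proof. by case: (Zar_valuation_ring V) => _; apply. Qed.

Lemma Zar_inj V W : (V : set F) = W -> V = W.
Proof.
case: V W => [V pV] [W pW] /= VW; case: _ / VW pW => pW.
by congr MkZar; exact: Prop_irrelevance.
Qed.

Lemma A_of_subring X : is_subring (A_of X).
Proof.
split.
- by apply/mem_set => V _; exact: subring1 (Zar_subring V).
- move=> x y /set_mem Ax /set_mem Ay; apply/mem_set => V XV.
  by apply: (subringB (Zar_subring V)); [exact: Ax|exact: Ay].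
- move=> x y /set_mem Ax /set_mem Ay; apply/mem_set => V XV.
  by apply: (subringM (Zar_subring V)); [exact: Ax|exact: Ay].
Qed.

Lemma A_of_sub X Y : X `<=` Y -> A_of Y `<=` A_of X.
Proof. by move=> XY t At V /XY; exact: At. Qed.

Lemma clopen_Zar (x : F) : clopen [set V : Zar F | Zar_set V x].
Proof.
have op (xs ys : seq F) : open (patch_basic xs ys).
  by rewrite openE => V VB; apply/patch_nbhsE; exists xs, ys; split.
split.
  have -> : [set V : Zar F | Zar_set V x] = patch_basic [:: x] [::].
    apply/seteqP; split => V; last by case=> + _; apply; rewrite inE.
    by move=> Vx; split => // y /[!inE] /eqP ->.
  exact: op.
have -> : [set V : Zar F | Zar_set V x] = ~` patch_basic [::] [:: x].
  apply/seteqP; split => V /=.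
    by move=> Vx [_ /(_ x)]; rewrite inE eqxx => /(_ erefl); exact.
  move=> nV; apply: contrapT => nVx; apply: nV.
  by split => // y /[!inE] /eqP ->.
by apply: open_closedC; exact: op.
Qed.

Lemma Zar_zero_dimensional : zero_dimensional (Zar F).
Proof.
move=> V W /eqP VW.
have [x|noV] := pselect (exists x, Zar_set V x /\ ~ Zar_set W x).
  case: x => x [Vx nWx]; exists [set U | Zar_set U x].
  by split; [exact: clopen_Zar| |].
have [x|noW] := pselect (exists x, Zar_set W x /\ ~ Zar_set V x).
  case: x => x [Wx nVx]; exists (~` [set U | Zar_set U x]).
  by split; [exact: clopenC setT (clopen_Zar x)| |apply].
case: VW; apply: Zar_inj; apply/seteqP; split => x Ux; apply: contrapT => nx.
  by apply: noV; exists x.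
by apply: noW; exists x.
Qed.

Lemma Zar_accessible : accessible_space (Zar F).
Proof.
move=> V W /Zar_zero_dimensional[U [[oU _] UV UW]].
by exists U; rewrite !inE.
Qed.

(** The limit of an ultrafilter U consists of the x that belong to V for
    U-almost every V: the valuation ring axioms pass to this set because each
    involves finitely many membership conditions. *)
Lemma Zar_compact : compact [set: Zar F].
Proof.
rewrite compact_ultra => U ultU _.
pose L : set F := [set x | U [set V | Zar_set V x]].
have nL x : ~ L x -> U (~` [set V : Zar F | Zar_set V x]).
  by have [] := in_ultra_setVsetC [set V : Zar F | Zar_set V x] ultU.
have Lval : is_valuation_ring L.
  split; first split.
  - apply/mem_set; apply: filterS filterT => V _.
    exact: subring1 (Zar_subring V).
  - move=> x y /set_mem Lx /set_mem Ly; apply/mem_set.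
    by apply: filterS2 Lx Ly => V; exact: subringB (Zar_subring V) _ _.
  - move=> x y /set_mem Lx /set_mem Ly; apply/mem_set.
    by apply: filterS2 Lx Ly => V; exact: subringM (Zar_subring V) _ _.
  - move=> t t0; have [|/nL nLt] := pselect (L t); [by left|right].
    by apply: filterS nLt => V nVt; case: (Zar_total V t0).
exists (MkZar Lval); split => // B /patch_nbhsE[xs [ys [[Lxs Lys] subB]]].
apply: filterS subB _.
have -> : patch_basic xs ys = [set V | forall x, x \in xs -> Zar_set V x] `&`
    [set V | forall y, y \in ys -> ~ Zar_set V y] by [].
apply: filterI.
  elim: xs Lxs => [|x xs IH] Lxs; first by apply: filterS filterT.
  have Ux : U [set V : Zar F | Zar_set V x] by apply: Lxs; rewrite inE eqxx.
  have Uxs := IH (fun z zxs => Lxs z (mem_behead (s := x :: xs) zxs)).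
  apply: filterS2 Ux Uxs => V Vx Vxs z.
  by rewrite inE => /predU1P[->|/Vxs].
elim: ys Lys => [|y ys IH] Lys; first by apply: filterS filterT.
have Uy : U (~` [set V : Zar F | Zar_set V y]).
  by apply: nL; apply: Lys; rewrite inE eqxx.
have Uys := IH (fun z zys => Lys z (mem_behead (s := y :: ys) zys)).
apply: filterS2 Uy Uys => V Vy Vys z.
by rewrite inE => /predU1P[->|/Vys].
Qed.

Lemma closed_compact_Zar X : closed X -> compact X.
Proof.
by move=> cX; apply: subclosed_compact cX Zar_compact _ => V.
Qed.

Lemma closure_min X Y : X `<=` Y -> closed Y -> closure X `<=` Y.
Proof. by move=> /closureS XY cY; exact: subset_trans XY cY. Qed.

Lemma A_of_closure X : A_of (closure X) = A_of X.
Proof.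
apply/seteqP; split; first exact/A_of_sub/subset_closure.
move=> t At V XV.
apply: (closure_min (Y := [set V | Zar_set V t])) XV => //.
by case: (clopen_Zar t).
Qed.

(** For j <> 0, being in the maximal ideal of V means that V contains j and not
    j^-1, which is a closed condition on V. *)
Lemma J_of_closure X : J_of X `<=` J_of (closure X).
Proof.
move=> j Jj V XV; rewrite maximal_ideal_ZarE; split.
  rewrite -[Zar_set V j]/([set V | Zar_set V j] V); apply: closure_min XV.
    by move=> W /Jj; rewrite maximal_ideal_ZarE => -[].
  by case: (clopen_Zar j).
have [->|j0] := eqVneq j 0; [by left|right].
apply: (closure_min (Y := ~` [set V | Zar_set V j^-1])) XV.
  move=> W /Jj; rewrite maximal_ideal_ZarE => -[_ []//] j00.
  by rewrite j00 eqxx in j0.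
by case: (clopenC setT (clopen_Zar j^-1)).
Qed.

(** An element outside A(X) is omitted on a nonempty compact subset of each
    closed set of the chain, hence is omitted by a member of their
    intersection.  Zorn's lemma is applied to the complements. *)
Lemma minimal_closed_representation X : closed X ->
  exists Z, [/\ closed Z, Z `<=` X, A_of Z = A_of X &
    forall Z', closed Z' -> Z' `<=` Z -> A_of Z' = A_of Z -> Z' = Z].
Proof.
move=> cX; pose P U := open U /\ A_of (X `\` U) = A_of X.
have [|U [[oU AU] Umax]] := @Zorn_bigcup _ P.
  move=> G GP Gtot; split; first by apply: bigcup_open => U /GP[].
  apply/seteqP; split; last by apply: A_of_sub => V [].
  move=> t At V XV; apply: contrapT => nVt.
  pose K := X `&` ~` [set W | Zar_set W t].
  have cK : compact K.
    apply: closed_compact_Zar; apply: closedI => //.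
    by have [] := clopenC setT (clopen_Zar t).
  have [G0|/set0P G0] := eqVneq G set0.
    by apply: nVt; apply: At; split => // -[U]; rewrite G0.
  have [U GU|W [[XW nWt] nGW]] := compact_chain_bigcup cK G0 Gtot; last first.
    by apply: nWt; exact: At.
  have [oU AU] := GP _ GU; split => //; apply: contrapT => noW.
  apply: nVt; suff : A_of X t by apply.
  rewrite -AU => W [XW nUW]; apply: contrapT => nWt; apply: noW.
  by exists W.
exists (X `\` U); split => //.
- by apply: closedI => //; exact: open_closedC.
move=> Z cZ ZXU AZ; apply/seteqP; split => // V [XV nUV].
apply: contrapT => nZV.
apply: (Umax (~` Z)).
  split; last by move=> /(_ _ nZV).
  by move=> W UW ZW; have [] := ZXU _ ZW.
split; first exact: closed_openC.
by rewrite setDE setCK setIidr ?AZ // => W /ZXU[].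
Qed.

(** The element t makes V irredundant in the representation of A(Z).  For a
    suitable s = j t^n, the element (1 + s)^-1 of A(Z) is in the maximal ideal of
    V and congruent to 1 modulo the maximal ideal of every other member of Z;
    locality allows this only when V is alone. *)
Lemma local_irredundant_valuation Z V t j :
    completely_integrally_closed (A_of Z) -> is_local_ring (A_of Z) ->
    j != 0 -> J_of Z j ->
    Z V -> A_of (Z `\ V) t -> ~ Zar_set V t ->
  A_of Z = V.
Proof.
move=> Acic Aloc j0 Jj ZV At nVt.
have Zj W : Z W -> Zar_set W j /\ ~ Zar_set W j^-1.
  move=> /Jj; rewrite maximal_ideal_ZarE => -[Wj [j00|]] //.
  by rewrite j00 eqxx in j0.
have t0 : t != 0.
  by apply/eqP => t0; apply: nVt; rewrite t0; exact: subring0 (Zar_subring V).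
have Aj : A_of Z j by move=> W /Zj[].
(* Otherwise j t^n is in A(Z) for all n; then t = (j t) / j is in the quotient
   field of A(Z), and it is almost integral over A(Z), so it is in V. *)
have [n nVs] : exists n, ~ Zar_set V (j * t ^+ n).
  apply: contrapT => /forallNP allV.
  have Ajt n : A_of Z (j * t ^+ n).
    move=> W ZW; have [->|/eqP WV] := eqVneq W V; first exact: contrapT.
    apply: (subringM (Zar_subring W)); first by have [] := Zj _ ZW.
    by apply: (subringX (Zar_subring W)); exact: At.
  apply: nVt; apply: (Acic t) ZV; last by exists j; split.
  exists (j * t ^+ 1), j; split => //.
  by rewrite expr1 mulrAC mulfV // mul1r.
set s := j * t ^+ n in nVs.
have s0 : s != 0 by rewrite mulf_neq0 // expf_neq0.
have nWsV W : Z W -> W <> V -> ~ Zar_set W s^-1.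
  move=> ZW WV Ws; have [_ +] := Zj _ ZW; apply.
  have -> : j^-1 = s^-1 * t ^+ n by rewrite invfM divfK // expf_neq0.
  apply: (subringM (Zar_subring W)) => //.
  by apply: (subringX (Zar_subring W)); exact: At.
have nV1s : ~ Zar_set V (1 + s).
  move=> V1s; apply: nVs; rewrite -(addKr 1 s) addrC.
  by apply: (subringB (Zar_subring V)) => //; exact: subring1 (Zar_subring V).
have s10 : 1 + s != 0.
  apply/eqP => s10; apply: nV1s; rewrite s10.
  exact: subring0 (Zar_subring V).
have comp : 1 - (1 + s)^-1 = s / (1 + s).
  by apply: (mulIf s10); rewrite mulrBl mul1r mulVf // mulfVK // addrC addKr.
have compV : (1 - (1 + s)^-1)^-1 = 1 + s^-1.
  by rewrite comp invf_div mulrDl mul1r divff // addrC.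
have nW1s W : Z W -> W <> V -> ~ Zar_set W (1 + s^-1).
  move=> ZW WV W1; apply: (nWsV _ ZW WV).
  rewrite -(addKr 1 s^-1) addrC; apply: (subringB (Zar_subring W)) => //.
  exact: subring1 (Zar_subring W).
(* Outside V the inverse of 1 - (1 + s)^-1 is missing, hence that element itself
   belongs to the valuation ring. *)
have Ae : A_of Z (1 + s)^-1.
  move=> W ZW; have [->|/eqP WV] := eqVneq W V.
    by case: (Zar_total V s10).
  rewrite -[_^-1](subKr 1); apply: (subringB (Zar_subring W)).
    exact: subring1 (Zar_subring W).
  case: (@Zar_total W (1 - (1 + s)^-1)) => //.
    by rewrite comp mulf_neq0 ?invr_eq0.
  by rewrite compV => /nW1s; case.
case: (local_ring_unit (A_of_subring Z) Aloc Ae).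
  by rewrite invrK => /(_ _ ZV).
rewrite compV => A1; apply/seteqP; split; first by move=> x; apply.
move=> x Vx W ZW; have [->//|/eqP WV] := eqVneq W V.
by have := nW1s _ ZW WV (A1 _ ZW).
Qed.

End ZariskiRiemann.

(** * Co-countable sets of limit points *)

Theorem corollary3p7 (F : fieldType) (X : set (Zar F))
  (X_neq0 : X !=set0)
  (JX_neq0 : J_of X <> [set 0])
  (AX_cic : completely_integrally_closed (A_of X))
  (AX_local : is_local_ring (A_of X))
  (AX_not_val : ~ is_valuation_ring (A_of X)) :
  forall Y : set (Zar F), Y `<=` limit_point X ->
    countable (limit_point X `\` Y) -> A_of X = A_of Y.
Proof.
move=> Y YX coY.
have [j [j0 Jj]] : exists j, j != 0 /\ J_of X j.
  apply: contrapT => noj; apply: JX_neq0; apply/seteqP; split => j.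
    by move=> Jj; apply/eqP/negP => /negP j0; apply: noj; exists j.
  move=> -> V _; rewrite maximal_ideal_ZarE.
  by split; [exact: subring0 (Zar_subring V)|left].
have [Z [cZ ZX AZ Zmin]] :=
  minimal_closed_representation (@closed_closure _ X).
rewrite A_of_closure in AZ.
(* An isolated point of Z is irredundant by minimality of Z. *)
have Zperf : Z `<=` limit_point Z.
  move=> V ZV; apply: contrapT => nlim.
  have nAZ : A_of (Z `\ V) <> A_of Z.
    move=> /(Zmin _ (closed_setD1 cZ nlim)) ZVZ.
    suff : (Z `\ V) V by case=> _; apply.
    by rewrite ZVZ // => W [].
  have [t [At nVt]] : exists t, A_of (Z `\ V) t /\ ~ Zar_set V t.
    apply: contrapT => noT; apply: nAZ; apply/seteqP; split; last first.
      by apply: A_of_sub => W [].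
    move=> t At W ZW; have [->|/eqP WV] := eqVneq W V; last exact: At.
    by apply: contrapT => nVt; apply: noT; exists t.
  apply: AX_not_val; rewrite -AZ.
  rewrite (@local_irredundant_valuation _ Z V t j) ?AZ //.
    exact: Zar_valuation_ring.
  by move=> W /ZX; exact: J_of_closure.
have ZlimX : Z `<=` limit_point X.
  move=> V /Zperf limZ; apply: limit_point_closure; first exact: Zar_accessible.
  by move=> U /limZ[W [WV /ZX XW UW]]; exists W.
apply/seteqP; split => t At.
  by rewrite -A_of_closure in At; move=> V /YX/subset_limit_point; exact: At.
rewrite -AZ => V ZV; apply: contrapT => nVt.
have cN := clopenC setT (clopen_Zar t).
apply: (@perfect_compact_uncountable _ (Z `&` ~` [set W | Zar_set W t])).
- exact: Zar_zero_dimensional.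
- by apply: closed_compact_Zar; apply: closedI => //; case: cN.
- by exists V.
- move=> W [ZW nWt] U WU.
  have [|W' [W'W ZW' [UW' nW't]]] :=
    Zperf _ ZW (U `&` ~` [set W | Zar_set W t]).
    by apply: filterI => //; apply: open_nbhs_nbhs; split => //; case: cN.
  by exists W'.
- apply: sub_countable coY; apply: subset_card_le => W [ZW nWt].
  by split; [exact: ZlimX|move=> /At].
Qed.
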